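(* Let $r \ge 2$ be an integer. Then $S_{(r,r)} \in \mathcal{L}_-$.
   Context: $\mathbb{N}=\{0,1,2,\dots\}$. $\mathcal{L}_-$ denotes the set of all submonoids $S$ of $(\mathbb{N},+)$ with $S \neq \{0\}$ such that $s+t-3,\ s+t-1,\ s+t+1 \in S$ for all $s,t \in S\setminus\{0,1\}$. A $(v,\beta,r,k)$-configuration is an incidence structure consisting of $v$ points and $\beta$ lines such that each point lies on exactly $r$ lines, each line contains exactly $k$ points, and any two distinct points lie on at most one common line. For integers $r,k \ge 2$, $S_{(r,k)}$ denotes the set of all $d \in \mathbb{N}$ for which there exists a $\bigl(d\cdot\frac{k}{\gcd(r,k)},\ d\cdot\frac{r}{\gcd(r,k)},\ r,\ k\bigr)$-configuration (with $d=0$ included via the empty configuration); in particular $S_{(r,r)}$ is the set of $d \in \mathbb{N}$ such that a $(d,d,r,r)$-configuration exists. *)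

(* Defs.v *)
From mathcomp Require Import all_boot.
From mathcomp Require Import classical_sets.

Set Implicit Arguments.
Unset Strict Implicit.
Unset Printing Implicit Defensive.

Local Open Scope classical_set_scope.

Definition submonoid (S : set nat) : Prop :=
  S 0 /\ forall s t : nat, S s -> S t -> S (s + t).

(* The truncated subtractions never truncate here, since s, t >= 2. *)
Definition Lminus : set (set nat) :=
  [set S | [/\ submonoid S,
               S <> [set 0] &
               forall s t : nat, (S `\` [set 0; 1]) s -> (S `\` [set 0; 1]) t ->
                 [/\ S (s + t - 3), S (s + t - 1) & S (s + t + 1)]]].

Record configuration (v b r k : nat) (P L : finType) (I : P -> L -> bool) :
    Prop := Configuration {
  card_points : #|P| = v;
  card_lines : #|L| = b;
  point_degree : forall p : P, #|[pred l | I p l]| = r;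
  line_degree : forall l : L, #|[pred p | I p l]| = k;
  common_line : forall (p q : P) (l m : L), p <> q ->
    I p l -> I q l -> I p m -> I q m -> l = m
}.

(* 0 belongs to this set because the incidence structure with no points and
   no lines is a (0, 0, r, k)-configuration. *)
Definition conf_set (r k : nat) : set nat :=
  [set d | exists (P L : finType) (I : P -> L -> bool),
     configuration (d * (k %/ gcdn r k)) (d * (r %/ gcdn r k)) r k I].

(* Main.v *)
Require Import Defs.
From mathcomp Require Import all_boot.
From mathcomp Require Import classical_sets.
From mathcomp Require Import boolp fintype finset zify.

(** A configuration is a biregular bipartite graph without 4-cycles. Let A and B
  be configurations with s and t points.

  Deleting a small subtree from A and the dual subtree from B leaves vertices
  that miss one incidence each; matching the deficient points of A with the
  deficient lines of B, and vice versa, restores all degrees and creates no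
  4-cycle. A single line against a single point gives s+t-1; a point with two
  of its lines against a line with two of its points gives s+t-3.

  For s+t+1 write r = n+1. Choose points q_0, ..., q_(n-1), alternately on a
  line of A and on a line of B, and for each j a set W_j of n-j further lines
  through q_j. A new point p takes over W_0, then q_0 takes over W_1, then q_1
  takes over W_2, and so on, except that q_j also keeps one line N_j of W_j.
  All points have the right degree again, p missing one line, while each N_j
  has one point too many and drops a point x_j. The dual chain k_0, ...,
  k_(n-1) of lines, alternately in B and in A, inserts a new line l and leaves
  lines y_j that miss one point. Adding the incidences (p, l) and (x_j, y_j)
  completes the new configuration. *)

Set Implicit Arguments.
Unset Strict Implicit.
Unset Printing Implicit Defensive.

(** * Incidence structures and gluing *)

Lemma configuration_dual v b r k (P L : finType) (I : P -> L -> bool) :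
  configuration v b r k I -> configuration b v k r (fun l p => I p l).
Proof.
case=> cP cL dP dL lin; split=> // l m p q lm Ipl Ipm Iql Iqm.
by apply/eqP; apply: contraT => /eqP pq; case: lm; apply: (lin p q).
Qed.

(** Incidences of [O] stay on one side and those of [X] change sides, so a 4-cycle contains an even
    number of the latter. The five last hypotheses treat none, two at a common point, two at a
    common line, two opposite ones, and four. *)
Lemma linear_union (P L : Type) (O X : P -> L -> bool) (sP : P -> bool)
    (sL : L -> bool) :
  (forall p l, O p l -> sP p = sL l) -> (forall p l, X p l -> sP p = ~~ sL l) ->
  (forall p q l m, p <> q -> O p l -> O q l -> O p m -> O q m -> l = m) ->
  (forall p q l m, X p l -> X p m -> O q l -> O q m -> l = m) ->
  (forall p q l m, X p l -> X q l -> O p m -> O q m -> p = q) ->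
  (forall p q l m, O p l -> O q m -> X p m -> X q l -> False) ->
  (forall p q l m, p <> q -> X p l -> X q l -> X p m -> X q m -> l = m) ->
  forall p q l m, p <> q -> O p l || X p l -> O q l || X q l ->
    O p m || X p m -> O q m || X q m -> l = m.
Proof.
move=> sO sX lO aX aX' bX lX p q l m pq.
move=> /orP[Hpl|Hpl] /orP[Hql|Hql] /orP[Hpm|Hpm] /orP[Hqm|Hqm];
  (* An odd number of side changes around the cycle is contradictory; this closes eight of the
     sixteen cases. *)
  try (by exfalso;
    (first [have := sO _ _ Hpl|have := sX _ _ Hpl]);
    (first [have := sO _ _ Hql|have := sX _ _ Hql]);
    (first [have := sO _ _ Hpm|have := sX _ _ Hpm]);
    (first [have := sO _ _ Hqm|have := sX _ _ Hqm]);
    case: (sP p) (sP q) (sL l) (sL m) => [] [] [] []).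
- exact: (lO p q).
- by case: pq; apply: (aX' _ _ m l).
- exact: (aX q p).
- by case: (bX p q l m).
- by case: (bX q p l m).
- exact: (aX p q).
- by case: pq; apply: (aX' _ _ l m).
- exact: (lX p q).
Qed.

Lemma card_sum_pred (S T : finType) (Q : pred (S + T)) :
  #|[pred u | Q u]| = #|[pred u | Q (inl u)]| + #|[pred u | Q (inr u)]|.
Proof. by rewrite -!sum1_card big_sumType. Qed.

Lemma card_sig_pred (T : finType) (A : {set T}) (Q : pred T) :
  #|[pred u : {x | x \in A} | Q (val u)]| = #|[pred u | (u \in A) && Q u]|.
Proof.
rewrite -(card_image val_inj); apply: eq_card => u; rewrite [RHS]inE.
apply/idP/andP => [/mapP[[x xA] /=]|[uA Qu]].
  by rewrite mem_enum inE /= => Qx ->.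
by apply/mapP; exists (Sub u uA); rewrite ?mem_enum ?inE.
Qed.

Lemma configuration_restrict (P L : finType) (J : P -> L -> bool)
    (A : {set P}) (B : {set L}) r k :
  (forall p, p \in A -> #|[pred l | (l \in B) && J p l]| = r) ->
  (forall l, l \in B -> #|[pred p | (p \in A) && J p l]| = k) ->
  (forall p q l m, p <> q -> J p l -> J q l -> J p m -> J q m -> l = m) ->
  configuration #|A| #|B| r k
    (fun (p : {p | p \in A}) (l : {l | l \in B}) => J (val p) (val l)).
Proof.
move=> dA dB lin; split.
- by rewrite card_sig; apply: eq_card.
- by rewrite card_sig; apply: eq_card.
- by move=> [p pA]; rewrite (card_sig_pred B (J p)) /= dA.
- by move=> [l lB]; rewrite (card_sig_pred A (fun p => J p l)) /= dB.
- move=> [p pA] [q qA] [l lB] [m mB] pq /= *; apply: val_inj => /=.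
  by apply: (lin p q) => // e; case: pq; apply: val_inj.
Qed.

(** Elements are paired when they have the same index in the enumerations of [A] and [B]. *)
Lemma matching_exists (S T : finType) (A : {set S}) (B : {set T}) :
  #|A| = #|B| -> exists M : S -> T -> bool,
  [/\ forall x y, M x y -> (x \in A) && (y \in B),
      forall x, #|[pred y | M x y]| = (x \in A),
      forall y, #|[pred x | M x y]| = (y \in B),
      forall x y y', M x y -> M x y' -> y = y' &
      forall x x' y, M x y -> M x' y -> x = x'].
Proof.
move=> AB.
pose M x y := [&& x \in A, y \in B & index x (enum A) == index y (enum B)].
have Mr x y y' : M x y -> M x y' -> y = y'.
  move=> /and3P[_ yB /eqP e] /and3P[_ yB' /eqP e'].
  by apply: (@index_inj _ y (enum B)); rewrite ?mem_enum // -e -e'.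
have Ml x x' y : M x y -> M x' y -> x = x'.
  move=> /and3P[yB _ /eqP e] /and3P[yB' _ /eqP e'].
  by apply: (@index_inj _ x (enum A)); rewrite ?mem_enum // e e'.
exists M; split=> //.
- by move=> x y /and3P[-> ->].
- move=> x; case: (boolP (x \in A)) => xA /=; last first.
    by apply: eq_card0 => y; rewrite !inE /M (negPf xA).
  have lt : index x (enum A) < size (enum B).
    by rewrite -cardE -AB cardE index_mem mem_enum.
  have y0 : T by case: (enum B) lt.
  rewrite -(card1 (nth y0 (enum B) (index x (enum A)))).
  have My : M x (nth y0 (enum B) (index x (enum A))).
    by rewrite /M xA -mem_enum mem_nth //= index_uniq // enum_uniq.
  by apply: eq_card => y; rewrite !inE; apply/idP/eqP => [/Mr|->]; [apply|].
- move=> y; case: (boolP (y \in B)) => yB /=; last first.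
    by apply: eq_card0 => x; rewrite !inE /M (negPf yB) andbF.
  have lt : index y (enum B) < size (enum A).
    by rewrite -cardE AB cardE index_mem mem_enum.
  have x0 : S by case: (enum A) lt.
  rewrite -(card1 (nth x0 (enum A) (index y (enum B)))).
  have My : M (nth x0 (enum A) (index y (enum B))) y.
    by rewrite /M yB -[X in X && _]mem_enum mem_nth //= index_uniq // enum_uniq.
  by apply: eq_card => x; rewrite !inE; apply/idP/eqP => [/Ml|->]; [apply|].
Qed.

Definition sum_inc (PA PB LA LB : Type) (IA : PA -> LA -> bool)
    (IB : PB -> LB -> bool) (p : PA + PB) (l : LA + LB) :=
  match p, l with
  | inl p, inl l => IA p l
  | inr p, inr l => IB p l
  | _, _ => false
  end.

Definition cross_inc (PA PB LA LB : Type) (M : PA -> LB -> bool)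
    (M' : PB -> LA -> bool) (p : PA + PB) (l : LA + LB) :=
  match p, l with
  | inl p, inr l => M p l
  | inr p, inl l => M' p l
  | _, _ => false
  end.

(** The side function supplied to [linear_union]: the second structure is the side [true]. *)
Definition is_inr (S T : Type) (u : S + T) := if u is inr _ then true else false.

Lemma sum_inc_linear (PA PB LA LB : finType) (IA : PA -> LA -> bool)
    (IB : PB -> LB -> bool) v b v' b' r k r' k' :
  configuration v b r k IA -> configuration v' b' r' k' IB ->
  forall p q l m, p <> q -> sum_inc IA IB p l -> sum_inc IA IB q l ->
    sum_inc IA IB p m -> sum_inc IA IB q m -> l = m.
Proof.
move=> cA cB [p|p] [q|q] [l|l] [m|m] //= pq h1 h2 h3 h4.
  by rewrite (common_line cA _ h1 h2 h3 h4) // => e; case: pq; rewrite e.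
by rewrite (common_line cB _ h1 h2 h3 h4) // => e; case: pq; rewrite e.
Qed.

Lemma sum_inc_configuration (PA PB LA LB : finType) (IA : PA -> LA -> bool)
    (IB : PB -> LB -> bool) v b v' b' r k :
  configuration v b r k IA -> configuration v' b' r k IB ->
  configuration (v + v') (b + b') r k (sum_inc IA IB).
Proof.
move=> cA cB; split.
- by rewrite card_sum (card_points cA) (card_points cB).
- by rewrite card_sum (card_lines cA) (card_lines cB).
- by case=> p; rewrite card_sum_pred /= ?(point_degree cA) ?(point_degree cB)
    eq_card0 // addn0.
- by case=> l; rewrite (card_sum_pred (fun p => sum_inc IA IB p _)) /=
    ?(line_degree cA) ?(line_degree cB) eq_card0 // addn0.
- exact: sum_inc_linear cA cB.
Qed.

Lemma card_residue (T : finType) (Q : pred T) (D : {set T}) c r :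
  #|[pred u | Q u]| = r -> #|[pred u | (u \in D) && Q u]| = c ->
  #|[pred u | (u \notin D) && Q u]| + c = r.
Proof.
move=> <- <-; rewrite addnC -(cardID D [pred u | Q u]); congr (_ + _).
by apply: eq_card => u; rewrite !inE andbC.
Qed.

(* [FP] and [FL] are the points and lines that lose exactly one incidence when
   the points of [DP] and the lines of [DL] are deleted. *)
Record cut (P L : finType) (I : P -> L -> bool) (DP : {set P}) (DL : {set L})
    (FP : {set P}) (FL : {set L}) : Prop := Cut {
  cut_points : forall p, p \notin DP ->
    #|[pred l | (l \in DL) && I p l]| = (p \in FP);
  cut_lines : forall l, l \notin DL ->
    #|[pred p | (p \in DP) && I p l]| = (l \in FL);
  cut_points_left : forall p, p \in FP -> p \notin DP;
  cut_lines_left : forall l, l \in FL -> l \notin DL;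
  cut_indep : forall p l, p \in FP -> l \in FL -> I p l = false
}.

Lemma cut_dual (P L : finType) (I : P -> L -> bool) DP DL FP FL :
  cut I DP DL FP FL -> cut (fun l p => I p l) DL DP FL FP.
Proof. by case=> h1 h2 h3 h4 h5; split=> // l p Fl Fp; apply: h5. Qed.

(** Matchings of [FPA] with [FLB] and of [FPB] with [FLA] give back each lost incidence. New
    incidences never share a vertex, so a 4-cycle with new ones could only have two, in opposite
    positions. *)
Lemma glue (PA LA PB LB : finType) (IA : PA -> LA -> bool)
    (IB : PB -> LB -> bool) s t r DPA DLA FPA FLA DPB DLB FPB FLB :
  configuration s s r r IA -> configuration t t r r IB ->
  cut IA DPA DLA FPA FLA -> cut IB DPB DLB FPB FLB ->
  #|FPA| = #|FLB| -> #|FPB| = #|FLA| ->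
  exists (P L : finType) (I : P -> L -> bool),
    configuration (s + t - (#|DPA| + #|DPB|)) (s + t - (#|DLA| + #|DLB|)) r r I.
Proof.
move=> cA cB uA uB /matching_exists[M [MF Mr Ml Mr1 Ml1]].
move=> /matching_exists[M' [MF' Mr' Ml' Mr1' Ml1']].
pose J p l := sum_inc IA IB p l || cross_inc M M' p l.
pose A := [set u : PA + PB | match u with inl p => p \notin DPA | inr p => p \notin DPB end].
pose B := [set u : LA + LB | match u with inl p => p \notin DLA | inr p => p \notin DLB end].
have cardsum (S T : finType) (D : {set S}) (E : {set T}) :
  #|[set u : S + T | match u with inl p => p \notin D | inr p => p \notin E end]|
   = #|S| + #|T| - (#|D| + #|E|).
  rewrite cardsE card_sum_pred.
  have -> : #|[pred u | u \notin D]| = #|~: D| by apply: eq_card => u; rewrite !inE.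
  have -> : #|[pred u | u \notin E]| = #|~: E| by apply: eq_card => u; rewrite !inE.
  by have := cardsC D; have := cardsC E; lia.
suff cJ : configuration #|A| #|B| r r
    (fun (p : {p | p \in A}) (l : {l | l \in B}) => J (val p) (val l)).
  move: cJ; rewrite !cardsum (card_points cA) (card_points cB).
  by rewrite (card_lines cA) (card_lines cB) => cJ; do 3! eexists; exact: cJ.
apply: configuration_restrict.
- case=> p; rewrite inE => pD; rewrite card_sum_pred.
    rewrite -(card_residue (point_degree cA p) (cut_points uA pD)) -Mr.
    congr (_ + _); apply: eq_card => l; rewrite !inE /J /= ?orbF //.
    by case: (boolP (M p l)); rewrite ?andbF // => /MF/andP[_ /(cut_lines_left uB) ->].
  rewrite -(card_residue (point_degree cB p) (cut_points uB pD)) -Mr' addnC.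
  congr (_ + _); apply: eq_card => l; rewrite !inE /J /= ?orbF //.
  by case: (boolP (M' p l)); rewrite ?andbF // => /MF'/andP[_ /(cut_lines_left uA) ->].
- case=> l; rewrite inE => lD; rewrite card_sum_pred.
    rewrite -(card_residue (line_degree cA l) (cut_lines uA lD)) -Ml'.
    congr (_ + _); apply: eq_card => p; rewrite !inE /J /= ?orbF //.
    by case: (boolP (M' p l)); rewrite ?andbF // => /MF'/andP[/(cut_points_left uB) ->].
  rewrite -(card_residue (line_degree cB l) (cut_lines uB lD)) -Ml addnC.
  congr (_ + _); apply: eq_card => p; rewrite !inE /J /= ?orbF //.
  by case: (boolP (M p l)); rewrite ?andbF // => /MF/andP[/(cut_points_left uA) ->].
have X1 p l m : cross_inc M M' p l -> cross_inc M M' p m -> l = m.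
  case: p l m => p [l|l] [m|m] //= h h'; first by rewrite (Mr1 _ _ _ h h').
  by rewrite (Mr1' _ _ _ h h').
have X2 p q l : cross_inc M M' p l -> cross_inc M M' q l -> p = q.
  case: p q l => p [q|q] [l|l] //= h h'; first by rewrite (Ml1 _ _ _ h h').
  by rewrite (Ml1' _ _ _ h h').
apply: (@linear_union _ _ _ _ (@is_inr _ _) (@is_inr _ _)).
- by case=> p [].
- by case=> p [].
- exact: sum_inc_linear cA cB.
- by move=> p q l m h1 h2 _ _; apply: X1 h1 h2.
- by move=> p q l m h1 h2 _ _; apply: X2 h1 h2.
(* One of the two old incidences of such a cycle lies in A and joins a deficient point to a
   deficient line. *)
- case=> p [] q [] l [] m //= h1 h2 h3 h4.
    have /andP[Fp _] := MF _ _ h3; have /andP[_ Fl] := MF' _ _ h4.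
    by move: h1; rewrite (cut_indep uA).
  have /andP[Fq _] := MF _ _ h4; have /andP[_ Fm] := MF' _ _ h3.
  by move: h2; rewrite (cut_indep uA).
- by move=> p q l m _ h1 _ h2 _; apply: X1 h1 h2.
Qed.

(** * Deleting small subtrees: s + t - 1 and s + t - 3; a nonempty configuration *)

Lemma conf_setE r d : 0 < r -> conf_set r r d <->
  exists (P L : finType) (I : P -> L -> bool), configuration d d r r I.
Proof. by move=> r0; rewrite /conf_set /= gcdnn divnn r0 muln1. Qed.

Lemma exists_flag v b r k (P L : finType) (I : P -> L -> bool) :
  configuration v b r k I -> 0 < v -> 0 < r -> exists p l, I p l.
Proof.
move=> c; rewrite -(card_points c) => /card_gt0P[p _].
by rewrite -(point_degree c p) => /card_gt0P[l Il]; exists p, l.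
Qed.

Lemma cut_line v b r k (P L : finType) (I : P -> L -> bool) m :
  configuration v b r k I ->
  cut I set0 [set m] [set p | I p m] set0 /\ #|[set p | I p m]| = k.
Proof.
move=> c; split; last by rewrite cardsE (line_degree c).
split=> [p _|l _|p _|l|p l _]; rewrite ?inE //.
  case: (boolP (I p m)) => Ipm /=.
    rewrite -(card1 m); apply: eq_card => l; rewrite !inE.
    by case: eqP => // ->.
  by apply: eq_card0 => l; rewrite !inE; case: eqP => // ->; apply/negbTE.
by apply: eq_card0 => p; rewrite !inE.
Qed.

(** The lines [m1] and [m2] meet only in [q], so every other point of them loses one incidence. A
    deficient point on a deficient line would have two common lines with [q]. *)
Lemma cut_vee v b r k (P L : finType) (I : P -> L -> bool) q m1 m2 :
  configuration v b r k I -> I q m1 -> I q m2 -> m1 <> m2 ->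
  let FP := [set p | (p != q) && (I p m1 || I p m2)] in
  let FL := [set l | [&& I q l, l != m1 & l != m2]] in
  [/\ cut I [set q] [set m1; m2] FP FL, #|FP| = (k.-1).*2 & #|FL| = r - 2].
Proof.
move=> c Iq1 Iq2 m12 FP FL.
have lin p : p != q -> I p m1 -> I p m2 -> False.
  by move=> /eqP pq I1 I2; apply: m12; apply: (common_line c pq).
split.
- split.
  + move=> p; rewrite inE => pq; rewrite inE pq /=.
    case: (boolP (I p m1)) (boolP (I p m2)) => I1 [] I2 /=.
    * by case: (lin p).
    * rewrite -(card1 m1); apply: eq_card => l; rewrite !inE.
      case: (eqVneq l m1) => [->|_] //=.
      by case: eqP => // ->; apply/negbTE.
    * rewrite -(card1 m2); apply: eq_card => l; rewrite !inE.
      case: (eqVneq l m2) => [->|_]; rewrite ?orbT ?orbF //.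
      by case: eqP => // ->; apply/negbTE.
    * apply: eq_card0 => l; rewrite !inE.
      by apply/negbTE/andP => -[/orP[]/eqP->]; apply/negP.
  + move=> l; rewrite !inE negb_or => lm; rewrite lm andbT.
    case: (boolP (I q l)) => Il /=.
      by rewrite -(card1 q); apply: eq_card => p; rewrite !inE; case: eqP => // ->.
    by apply: eq_card0 => p; rewrite !inE; case: eqP => // ->; apply/negbTE.
  + by move=> p; rewrite !inE => /andP[].
  + by move=> l; rewrite !inE negb_or => /andP[].
  + move=> p l; rewrite !inE => /andP[/eqP pq Ip] /and3P[Iql l1 l2].
    apply/negbTE/negP => Ipl; case/orP: Ip => Ip.
      by case/eqP: l1; apply: (common_line c pq).
    by case/eqP: l2; apply: (common_line c pq).
- have h m : I q m -> #|[set p | (p != q) && I p m]| = k.-1.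
    move=> Iqm; rewrite -(line_degree c m) [in RHS](cardD1 q) inE Iqm /= cardsE.
    by apply: eq_card => p; rewrite !inE.
  have -> : FP = [set p | (p != q) && I p m1] :|: [set p | (p != q) && I p m2].
    by apply/setP => p; rewrite !inE andb_orr.
  rewrite cardsU !h // (_ : _ :&: _ = set0) ?cards0; first by lia.
  apply/setP => p; rewrite !inE; apply/negbTE/negP.
  by move=> /andP[/andP[pq I1] /andP[_ I2]]; case: (lin p).
- have m21 : m2 != m1 by apply/eqP => e; case: m12.
  have dq := point_degree c q.
  rewrite (cardD1 m1) (cardD1 m2 [predD1 _ & m1]) !inE Iq1 Iq2 m21 /= in dq.
  rewrite -dq cardsE !addSn !add0n subn2 /=; apply: eq_card => l; rewrite !inE.
  by rewrite unfold_in; case: (l == m1); case: (l == m2); case: (I q l).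
Qed.

Lemma exists_vee v b r k (P L : finType) (I : P -> L -> bool) :
  configuration v b r k I -> 0 < v -> 1 < r ->
  exists q m1 m2, [/\ I q m1, I q m2 & m1 <> m2].
Proof.
move=> c; rewrite -(card_points c) => /card_gt0P[q _].
rewrite -(point_degree c q) => /card_gt1P[m1 [m2 [I1 I2 /eqP m12]]].
by exists q, m1, m2; split.
Qed.

Lemma configuration_sub1 r s t (PA LA PB LB : finType) (IA : PA -> LA -> bool)
    (IB : PB -> LB -> bool) :
  configuration s s r r IA -> configuration t t r r IB ->
  0 < s -> 0 < t -> 0 < r -> exists (P L : finType) (I : P -> L -> bool),
  configuration (s + t - 1) (s + t - 1) r r I.
Proof.
move=> cA cB s0 t0 r0.
have [_ [m _]] := exists_flag cA s0 r0; have [q _] := exists_flag cB t0 r0.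
have [uA FA] := cut_line m cA.
have [/cut_dual uB FB] := cut_line q (configuration_dual cB).
have := glue cA cB uA uB; rewrite !cards0 !cards1 FA FB; exact.
Qed.

Lemma configuration_sub3 r s t (PA LA PB LB : finType) (IA : PA -> LA -> bool)
    (IB : PB -> LB -> bool) :
  configuration s s r r IA -> configuration t t r r IB ->
  0 < s -> 0 < t -> 1 < r -> exists (P L : finType) (I : P -> L -> bool),
  configuration (s + t - 3) (s + t - 3) r r I.
Proof.
move=> cA cB s0 t0 r1.
have [q [m1 [m2 [I1 I2 m12]]]] := exists_vee cA s0 r1.
have cB' := configuration_dual cB.
have [m [q1 [q2 [J1 J2 q12]]]] := exists_vee cB' t0 r1.
have [uA FA GA] := cut_vee cA I1 I2 m12.
have [/cut_dual uB FB GB] := cut_vee cB' J1 J2 q12.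
(* The deficient sets to be matched have sizes 2(r - 1) and r - 2. In all, 1 + 2 points and 2 + 1
   lines are deleted. *)
have := glue cA cB uA uB; rewrite FA FB GA GB !cards1 !cards2.
by move/eqP: m12 => ->; move/eqP: q12 => ->; apply.
Qed.

(* The line [(b, y)] is the graph of [a |-> y - a b] modulo [2 r^2 + 1], a
   modulus large enough for the products [a b] not to wrap around. *)
Lemma configuration_exists r : 0 < r -> exists d,
  0 < d /\ exists (P L : finType) (I : P -> L -> bool), configuration d d r r I.
Proof.
move=> r0; set Q := (2 * r * r).+1.
pose f (a b : 'I_r) (x : 'I_Q) : 'I_Q := inord ((x + a * b) %% Q).
have fE a b x : (f a b x : nat) = (x + a * b) %% Q.
  by rewrite inordK // ltn_mod.
have finj a b : injective (f a b).
  move=> x x' /(congr1 val) /=; rewrite !fE => /eqP; rewrite eqn_modDr.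
  by rewrite !modn_small // => /eqP/val_inj.
exists (r * Q); split; first by rewrite muln_gt0 r0.
exists ('I_r * 'I_Q)%type, ('I_r * 'I_Q)%type.
exists (fun p l => l.2 == f p.1 l.1 p.2); split.
- by rewrite card_prod !card_ord.
- by rewrite card_prod !card_ord.
- move=> [a x]; rewrite -[RHS](card_ord r).
  rewrite -(card_imset (f := fun b : 'I_r => (b, f a b x))) => [|b b' []//].
  apply: eq_card => -[b y]; rewrite inE /=.
  apply/eqP/imsetP => [->|[b' _ [-> ->]]] //; by exists b.
- move=> [b y]; rewrite -[RHS](card_ord r).
  pose g a := invF (finj a b) y.
  rewrite -(card_imset (f := fun a : 'I_r => (a, g a))) => [|a a' []//].
  apply: eq_card => -[a x]; rewrite inE /=.
  apply/eqP/imsetP => [e|[a' _ [-> ->]]].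
    by exists a => //; rewrite /g e invF_f.
  by rewrite /g f_invF.
move=> [a x] [a' x'] [b y] [b' y'] /= ne /eqP e1 /eqP e2 /eqP e3 /eqP e4.
have aa : a <> a'.
  by move=> e; case: ne; rewrite -e in e2 *; rewrite (finj a b x x') // -e1.
suff e : b = b' by rewrite e1 e3 e.
apply: val_inj => /=.
(* Both sides are y + y' modulo [Q]. Cancelling x + x' leaves two sums of at most 2r^2 < [Q], hence
   an equality of natural numbers, (a - a')(b - b') = 0 in effect. *)
have h : (x + a * b) + (x' + a' * b') = (x' + a' * b) + (x + a * b') %[mod Q].
  by rewrite -modnDm -[RHS]modnDm -!fE -e1 -e2 -e3 -e4.
have : a * b + a' * b' = a' * b + a * b' %[mod Q].
  apply/eqP; rewrite -(eqn_modDl (x + x')); apply/eqP.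
  by rewrite addnACA h; congr (_ %% _); lia.
have lt (i j : 'I_r) : i * j <= r * r by apply: leq_mul; apply: ltnW.
rewrite !modn_small; first last.
- by rewrite /Q; have := lt a b; have := lt a' b'; lia.
- by rewrite /Q; have := lt a' b; have := lt a b'; lia.
have : (a : nat) <> a' by move=> /val_inj.
nia.
Qed.

(** * Adding a point and a line *)

(* [W j] is a set of lines through [q j], all of which but [N j] will leave
   [q j] for the preceding centre; [N j] then has one point too many and drops
   [x j]. Only indices [j < n] satisfying [e] are constrained. *)
Record pencils (P L : finType) (I : P -> L -> bool) (n : nat) (e : pred nat)
    (q x : nat -> P) (N : nat -> L) (W : nat -> {set L}) : Prop := Pencils {
  pencil_card : forall j, j < n -> e j -> #|W j| = n - j;
  pencil_inc : forall j t, j < n -> e j -> t \in W j -> I (q j) t;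
  pencil_uniq : forall i j t, i < n -> e i -> j < n -> e j ->
    t \in W j -> I (q i) t -> i = j;
  pencil_head : forall j, j < n -> e j -> N j \in W j;
  pencil_exit : forall j, j < n -> e j -> I (x j) (N j);
  pencil_neq : forall j, j < n -> e j -> x j <> q j;
  pencil_inj : forall i j, i < n -> e i -> j < n -> e j -> x i = x j -> i = j
}.

(** The vertex that takes over the pencil [W j]; [None] stands for the new point, or dually for the
    new line. *)
Definition centre (T : Type) (q : nat -> T) (j : nat) : option T :=
  if j is j'.+1 then Some (q j') else None.

Definition leaves (P L : finType) n (q x : nat -> P) (N : nat -> L)
    (W : nat -> {set L}) (a : P) (t : L) :=
  [exists j : 'I_n, (a == q j) && (t \in W j :\ N j) || (a == x j) && (t == N j)].

Definition joins (P L : finType) n (q : nat -> P) (W : nat -> {set L})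
    (a : option P) (t : option L) :=
  [exists j : 'I_n, (a == centre q j) && (t \in [set Some u | u in W j])].

Definition links (P L : finType) n (x : nat -> P) (y : nat -> L)
    (a : option P) (t : option L) :=
  [exists j : 'I_n, (a == Some (x j)) && (t == Some (y j))].

Section Extension.

Variables (P L : finType) (I : P -> L -> bool) (n : nat).
Variables (q x z : nat -> P) (k y N : nat -> L).
Variables (W : nat -> {set L}) (V : nat -> {set P}).

(** The chain of lines is the dual data: [k], [y], [z], [V] take the places of [q], [x], [N],
    [W]. *)
Definition kept (a : option P) (t : option L) :=
  match a, t with
  | Some a, Some t => [&& I a t, ~~ leaves n q x N W a t & ~~ leaves n k y z V t a]
  | _, _ => false
  end.

Definition added (a : option P) (t : option L) :=
  [|| joins n q W a t, joins n k V t a, links n x y a t | (a == None) && (t == None)].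

Definition extension (a : option P) (t : option L) := kept a t || added a t.

Variant added_spec (a : option P) (t : option L) : Prop :=
  | AddedPencil j u of j < n & u \in W j & a = centre q j & t = Some u
  | AddedRange j b of j < n & b \in V j & a = Some b & t = centre k j
  | AddedLink j of j < n & a = Some (x j) & t = Some (y j)
  | AddedNew of a = None & t = None.

Lemma addedP a t : reflect (added_spec a t) (added a t).
Proof.
apply: (iffP idP) => [/or4P[]|].
- move=> /existsP[j /andP[/eqP-> /imsetP[u uW ->]]].
  exact: (@AddedPencil _ _ j u).
- move=> /existsP[j /andP[/eqP-> /imsetP[u uW ->]]].
  exact: (@AddedRange _ _ j u).
- by move=> /existsP[j /andP[/eqP-> /eqP->]]; exact: (@AddedLink _ _ j).
- by move=> /andP[/eqP-> /eqP->]; apply: AddedNew.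
rewrite /added; case=> [j u jn uW|j u jn uV|j jn|] -> -> //; last by rewrite !orbT.
- apply/or4P/Or41/existsP; exists (Ordinal jn).
  by rewrite eqxx imset_f.
- apply/or4P/Or42/existsP; exists (Ordinal jn).
  by rewrite eqxx imset_f.
- by apply/or4P/Or43/existsP; exists (Ordinal jn); rewrite !eqxx.
Qed.

End Extension.

(* The two chains together: [sP] and [sL] tell on which side (A is [false]) a
   point or a line lies. *)
Record interlock (P L : finType) (I : P -> L -> bool) n q x z k y N W V
    (sP : P -> bool) (sL : L -> bool) : Prop := Interlock {
  lock_points : pencils I n xpredT q x N W;
  lock_lines : pencils (fun l p => I p l) n xpredT k y z V;
  lock_side : forall a t, I a t -> sP a = sL t;
  lock_sideP : forall j, j < n -> sP (q j) = odd j;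
  lock_sideL : forall j, j < n -> sL (k j) = ~~ odd j;
  lock_qk : forall i j, i < n -> j < n -> I (q i) (k j) = false;
  lock_qy : forall i j, i < n -> j < n -> I (q i) (y j) = false;
  lock_xk : forall i j, i < n -> j < n -> I (x i) (k j) = false;
  lock_xy : forall i j, i < n -> j < n -> I (x i) (y j) -> I (x j) (y i) -> False
}.

(** * Absence of 4-cycles in the extension *)

Section Interlock.

Variables (P L : finType) (I : P -> L -> bool) (n : nat).
Variables (q x z : nat -> P) (k y N : nat -> L).
Variables (W : nat -> {set L}) (V : nat -> {set P}).
Variables (sP : P -> bool) (sL : L -> bool).
Hypothesis lin : forall p q l m, p <> q -> I p l -> I q l -> I p m -> I q m -> l = m.
Hypothesis lock : interlock I n q x z k y N W V sP sL.

Let pq := lock_points lock.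
Let pk := lock_lines lock.

Lemma pencil_q_inj i j : i < n -> j < n -> q i = q j -> i = j.
Proof.
move=> ii jj e; apply: (pencil_uniq pq (t := N j)) => //.
  exact: (pencil_head pq).
by rewrite e; apply: (pencil_inc pq) => //; apply: (pencil_head pq).
Qed.

(** The point [x i] lies on [N i], whose only centre is [q i], and differs from [q i]. *)
Lemma pencil_x_neq_q i j : i < n -> j < n -> x i <> q j.
Proof.
move=> ii jj e; have h := pencil_head pq ii isT.
have ij : j = i.
  by apply: (pencil_uniq pq _ _ _ _ h) => //; rewrite -e; apply: (pencil_exit pq).
by apply: (pencil_neq pq ii) => //; rewrite e ij.
Qed.

Lemma q_notin_V i j : i < n -> j < n -> q i \in V j -> False.
Proof.
by move=> ii jj /(pencil_inc pk jj isT) /=; rewrite (lock_qk lock).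
Qed.

Lemma x_notin_V i j : i < n -> j < n -> x i \in V j -> False.
Proof.
by move=> ii jj /(pencil_inc pk jj isT) /=; rewrite (lock_xk lock).
Qed.

Lemma k_notin_W i j : i < n -> j < n -> k i \in W j -> False.
Proof. by move=> ii jj /(pencil_inc pq jj isT); rewrite (lock_qk lock). Qed.

Lemma y_notin_W i j : i < n -> j < n -> y i \in W j -> False.
Proof. by move=> ii jj /(pencil_inc pq jj isT); rewrite (lock_qy lock). Qed.

Lemma W_disjoint i j t : i < n -> j < n -> t \in W i -> t \in W j -> i = j.
Proof.
by move=> ii jj ti tj; apply: (pencil_uniq pq ii isT jj isT tj); apply: (pencil_inc pq).
Qed.

Lemma V_disjoint i j a : i < n -> j < n -> a \in V i -> a \in V j -> i = j.
Proof.
by move=> ii jj ti tj; apply: (pencil_uniq pk ii isT jj isT tj); apply: (pencil_inc pk).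
Qed.

Local Notation kept := (kept I n q x z k y N W V).
Local Notation added := (added n q x k y W V).

Lemma centre_inj i j : i < n -> j < n -> centre q i = centre q j -> i = j.
Proof.
case: i j => [|i] [|j] //= ii jj [/pencil_q_inj-> //]; exact: ltnW.
Qed.

Lemma pencil_leaves t j : j < n -> t \in W j -> kept (Some (q j)) (Some t) -> t = N j.
Proof.
move=> jj tW /and3P[_ + _]; rewrite negb_exists => /forallP/(_ (Ordinal jj)).
by rewrite negb_or eqxx /= in_setD1 tW andbT negbK => /andP[/eqP].
Qed.

(** Each chain alternates between the sides, so [W j] and the vertex taking it over lie on opposite
    sides. The defaults put the new point with B and the new line with A, since [q 0] is in A and
    [k 0] in B. *)
Lemma added_side a t : added a t -> oapp sP true a = ~~ oapp sL false t.
Proof.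
move=> /addedP[j u jj uW -> ->|j b jj bV -> ->|j jj -> ->|-> ->] //=.
- have -> : sL u = odd j.
    by rewrite -(lock_sideP lock jj); apply/esym/(lock_side lock)/(pencil_inc pq).
  by case: j jj {uW} => //= j jj; rewrite (lock_sideP lock) 1?ltnW // negbK.
- have -> : sP b = ~~ odd j.
    by rewrite -(lock_sideL lock jj); apply/(lock_side lock)/(pencil_inc pk).
  by case: j jj {bV} => //= j jj; rewrite (lock_sideL lock) 1?ltnW.
- rewrite (lock_side lock (pencil_exit pq jj isT)).
  rewrite -(lock_side lock (pencil_exit pk jj isT)).
  rewrite -(lock_side lock (pencil_inc pq jj isT (pencil_head pq jj isT))).
  rewrite (lock_side lock (pencil_inc pk jj isT (pencil_head pk jj isT))).
  by rewrite (lock_sideP lock) // (lock_sideL lock) // negbK.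
Qed.

(** Two new incidences of a point with old lines come from one pencil [W j]. Its lines meet only in
    [q j], which keeps none of them but [N j]. *)
Lemma added_point_functional a b t u :
  added a t -> added a u -> kept b t -> kept b u -> t = u.
Proof.
move=> /addedP[j c jj cW -> ->|j c jj cV -> ->|j jj -> ->|-> ->] //=; last by case: b.
- move=> /addedP[i d ii dW e ->|i d ii dV + ->|i ii + ->|_ ->]; last by case: b.
  + have {ii e}ij := centre_inj jj ii e; rewrite -ij in dW.
    case: b => [b|] //= hc hd; congr Some.
    have [eb|/eqP bq] := eqVneq b (q j).
      by rewrite eb in hc hd; rewrite (pencil_leaves jj cW) // (pencil_leaves jj dW).
    case/andP: hc => hc _; case/andP: hd => hd _.
    by apply: (lin bq) => //; apply: (pencil_inc pq).
  + case: j jj {cW} => //= j jj [e]; case: (q_notin_V (ltnW jj) ii).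
    by rewrite e.
  + by case: j jj {cW} => //= j jj [/esym/pencil_x_neq_q[]//]; apply: ltnW.
- move=> /addedP[i d ii dW + ->|i d ii dV [e] ->|i ii [e] ->|//].
  + by case: i ii {dW} => //= i ii [e]; case: (q_notin_V (ltnW ii) jj); rewrite -e.
  + by rewrite -e in dV; rewrite (V_disjoint jj ii cV dV).
  + by case: (x_notin_V ii jj); rewrite -e.
- move=> /addedP[i d ii dW + ->|i d ii dV [e] ->|i ii [e] ->|//].
  + by case: i ii {dW} => //= i ii [/pencil_x_neq_q[]//]; apply: ltnW.
  + by case: (x_notin_V jj ii); rewrite e.
  + by rewrite (pencil_inj pq jj isT ii isT e).
Qed.

(** Two incidences from the same chain would make each of two indices the successor of the other. In
    all remaining combinations an old incidence joins some [q] or [x] to some [k] or [y], against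
    the conditions of [interlock]. *)
Lemma added_no_path a b t u :
  kept a t -> kept b u -> added a u -> added b t -> False.
Proof.
case: a b t u => [a|] [b|] [t|] [u|] //= /andP[at_ _] /andP[bu _].
move=> /addedP[j c jj cW + [uc]|j c jj cV [ac]|j jj [aj] [uj]|//].
- case: j jj cW => //= j jj cW [aj].
  move=> /addedP[i d ii dW + [td]|i d ii dV _|i ii _ [ti]|//].
  + case: i ii dW => //= i ii dW [bi].
    have := pencil_uniq pq (ltnW jj) isT ii isT dW; rewrite -aj -td => /(_ at_).
    have := pencil_uniq pq (ltnW ii) isT jj isT cW; rewrite -bi -uc => /(_ bu).
    lia.
  + case: i ii {dV} => //= i ii [ti].
    by move: at_; rewrite aj ti (lock_qk lock) // ltnW.
  + by move: at_; rewrite aj ti (lock_qy lock) // ltnW.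
- case: j jj cV => //= j jj cV [uj].
  move=> /addedP[i d ii dW + _|i d ii dV [bd]|i ii [bi] _|//].
  + case: i ii {dW} => //= i ii [bi].
    by move: bu; rewrite bi uj (lock_qk lock) // ltnW.
  + case: i ii dV => //= i ii dV [ti].
    have := pencil_uniq pk (ltnW ii) isT jj isT cV; rewrite -ac -ti => /(_ at_).
    have := pencil_uniq pk (ltnW jj) isT ii isT dV; rewrite -bd -uj => /(_ bu).
    lia.
  + by move: bu; rewrite bi uj (lock_xk lock) // ltnW.
- move=> /addedP[i d ii dW + _|i d ii dV _|i ii [bi] [ti]|//].
  + case: i ii {dW} => //= i ii [bi].
    by move: bu; rewrite bi uj (lock_qy lock) // ltnW.
  + case: i ii {dV} => //= i ii [ti].
    by move: at_; rewrite aj ti (lock_xk lock) // ltnW.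
  + by move: at_ bu; rewrite aj uj bi ti; apply: (lock_xy lock).
Qed.

(** A cycle needs two new incidences at each vertex, but a line of [W j], a point of [V j] and a
    point [x j] each gain only one. *)
Lemma added_linear a b t u :
  a <> b -> added a t -> added b t -> added a u -> added b u -> t = u.
Proof.
have rangeE c j w : j < n -> c \in V j -> added (Some c) w -> w = centre k j.
  move=> jj cV /addedP[i d ii dW + ->|i d ii dV [e] ->|i ii [e] ->|//].
  + by case: i ii {dW} => //= i ii [e]; case: (q_notin_V (ltnW ii) jj); rewrite -e.
  + by rewrite -e in dV; rewrite (V_disjoint jj ii cV dV).
  + by case: (x_notin_V ii jj); rewrite -e.
move=> ab /addedP[j c jj cW aj tc|j c jj cV ac tj|j jj aj tj|an tn].
- move=> /addedP[i d ii dW bi|i d ii dV _|i ii _|_]; rewrite tc //.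
  + by move=> [e]; rewrite -e in dW; case: ab; rewrite aj bi (W_disjoint jj ii cW dW).
  + by case: i ii {dV} => //= i ii [e]; case: (k_notin_W (ltnW ii) jj); rewrite -e.
  + by move=> [e]; case: (y_notin_W ii jj); rewrite -e.
- by move=> _; rewrite ac => /(rangeE _ _ _ jj cV) ->.
- move=> _; rewrite aj tj => /addedP[i d ii dW + ->|i d ii dV [e] ->|i ii [e] ->|//].
  + by case: i ii {dW} => //= i ii [/pencil_x_neq_q[]//]; apply: ltnW.
  + by case: (x_notin_V jj ii); rewrite e.
  + by rewrite (pencil_inj pq jj isT ii isT e).
- rewrite tn an => /addedP[//|i d ii dV bd e|//|bn _].
    by move=> _; rewrite bd => /(rangeE _ _ _ ii dV) ->.
  by case: ab; rewrite an bn.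
Qed.

End Interlock.

(** The sides are complemented because the dual chain starts with [k 0], which lies in B. *)
Lemma interlock_dual (P L : finType) (I : P -> L -> bool) n q x z k y N W V sP sL :
  interlock I n q x z k y N W V sP sL ->
  interlock (fun l p => I p l) n k y N q x z V W (fun l => ~~ sL l) (fun p => ~~ sP p).
Proof.
case=> h1 h2 h3 h4 h5 h6 h7 h8 h9; split=> //.
- by move=> a t /h3 ->.
- by move=> j /h5 ->; rewrite negbK.
- by move=> j /h4 ->.
- by move=> i j *; apply: h6.
- by move=> i j *; apply: h8.
- by move=> i j *; apply: h7.
- by move=> i j ii jj a b; apply: (h9 j i).
Qed.

Lemma kept_dual (P L : finType) (I : P -> L -> bool) n q x z k y N W V a t :
  kept I n q x z k y N W V a t = kept (fun l p => I p l) n k y N q x z V W t a.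
Proof. by case: a t => [a|] [t|] //=; congr (_ && _); rewrite andbC. Qed.

Lemma added_dual (P L : finType) n q x k y (W : nat -> {set L}) (V : nat -> {set P}) a t :
  added n q x k y W V a t = added n k y q x V W t a.
Proof.
rewrite /added (andbC (a == None)) orbCA; congr [|| _, _, _ | _].
by apply: eq_existsb => j; rewrite andbC.
Qed.

Lemma interlock_linear (P L : finType) (I : P -> L -> bool) n q x z k y N W V sP sL :
  (forall p q l m, p <> q -> I p l -> I q l -> I p m -> I q m -> l = m) ->
  interlock I n q x z k y N W V sP sL ->
  forall a b t u, a <> b -> extension I n q x z k y N W V a t ->
    extension I n q x z k y N W V b t -> extension I n q x z k y N W V a u ->
    extension I n q x z k y N W V b u -> t = u.
Proof.
move=> lin lock.
apply: (@linear_union _ _ _ _ (oapp sP true) (oapp sL false)).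
- by case=> [a|] [t|] //= /andP[/(lock_side lock)].
- by move=> a t; apply: added_side lock _ _.
- move=> [p|] [p'|] [l|] [m|] //= pp /andP[h1 _] /andP[h2 _] /andP[h3 _] /andP[h4 _].
  by congr Some; apply: (lin p p') => // e; case: pp; rewrite e.
- by move=> p p' l m; apply: (added_point_functional lin lock).
- move=> p p' l m; rewrite added_dual => h1; rewrite added_dual => h2.
  rewrite kept_dual => h3; rewrite kept_dual => h4.
  apply: (added_point_functional _ (interlock_dual lock) h1 h2 h3 h4).
  move=> l' m' p1 p2 lm g1 g2 g3 g4.
  by apply/eqP; apply: contraT => /eqP pp; case: lm; apply: (lin p1 p2).
- by move=> p p' l m; apply: (added_no_path lock).
- by move=> p p' l m; apply: (added_linear lock).
Qed.

Lemma leavesP (P L : finType) n q x N (W : nat -> {set L}) (a : P) (t : L) :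
  reflect (exists2 j, j < n & [/\ a = q j, t \in W j & t <> N j] \/ (a = x j /\ t = N j))
    (leaves n q x N W a t).
Proof.
apply: (iffP existsP) => [[j h]|[j jj h]].
  exists j => //; case/orP: h => [/andP[/eqP-> /setD1P[/eqP h1 h2]]|/andP[/eqP-> /eqP->]].
    by left.
  by right.
exists (Ordinal jj) => /=; case: h => [[-> h1 /eqP h2]|[-> ->]].
  by rewrite eqxx in_setD1 h1 h2.
by rewrite !eqxx orbT.
Qed.

(** * Degrees in the extension *)

Section Degree.

Variables (P L : finType) (I : P -> L -> bool) (n : nat).
Variables (q x z : nat -> P) (k y N : nat -> L).
Variables (W : nat -> {set L}) (V : nat -> {set P}).
Variables (sP : P -> bool) (sL : L -> bool).
Hypothesis lock : interlock I n q x z k y N W V sP sL.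

Let pq := lock_points lock.
Let pk := lock_lines lock.

Local Notation kept := (kept I n q x z k y N W V).
Local Notation added := (added n q x k y W V).
Local Notation extension := (extension I n q x z k y N W V).

Definition dropped a t := leaves n q x N W a t || leaves n k y z V t a.

Variant dropped_spec (a : P) (t : L) : Prop :=
  | DroppedPencil j of j < n & a = q j & t \in W j & t <> N j
  | DroppedExit j of j < n & a = x j & t = N j
  | DroppedRange j of j < n & t = k j & a \in V j & a <> z j
  | DroppedEntry j of j < n & t = y j & a = z j.

Lemma droppedP a t : reflect (dropped_spec a t) (dropped a t).
Proof.
apply: (iffP orP) => [[]/leavesP[j jj [[]|[]]]|].
- exact: DroppedPencil.
- exact: DroppedExit.
- exact: DroppedRange.
- exact: DroppedEntry.
case=> j jj *; [left|left|right|right]; apply/leavesP; exists j => //;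
  by [left|right].
Qed.

Lemma dropped_inc a t : dropped a t -> I a t.
Proof.
case/droppedP=> j jj.
- by move=> -> tW _; apply: (pencil_inc pq).
- by move=> -> ->; apply: (pencil_exit pq).
- by move=> -> aV _; apply: (pencil_inc pk).
- by move=> -> ->; apply: (pencil_exit pk).
Qed.

Lemma dropped_q i t : i < n -> dropped (q i) t = (t \in W i :\ N i).
Proof.
move=> ii; apply/droppedP/setD1P => [[] j jj|[/eqP tN tW]].
- by move=> /(pencil_q_inj lock ii jj) <- tW /eqP.
- by move=> /esym/(pencil_x_neq_q lock jj ii).
- by move=> _ /(q_notin_V lock ii jj).
- by move=> _ e; case: (q_notin_V lock ii jj); rewrite e; apply: (pencil_head pk).
exact: (@DroppedPencil _ _ i).
Qed.

Lemma added_q i t : i < n ->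
  added (Some (q i)) t = (i.+1 < n) && (t \in [set Some u | u in W i.+1]).
Proof.
move=> ii; apply/addedP/andP => [[j u jj uW e ->|j u jj uV [e]|j jj [e]|//]|].
- have {}e : i.+1 = j.
    by case: j jj {uW} e => //= j jj [/(pencil_q_inj lock ii (ltnW jj)) ->].
  by rewrite e imset_f.
- by case: (q_notin_V lock ii jj); rewrite e.
- by case: (pencil_x_neq_q lock jj ii).
case=> lt /imsetP[u uW ->]; exact: (@AddedPencil _ _ _ _ _ _ _ _ _ _ _ i.+1 u).
Qed.

(** A point of [V i] moves from [k i] to the preceding centre, except that [z i] stays on [k i] and
    leaves [y i] instead. *)
Lemma dropped_V i a t : i < n -> a \in V i ->
  dropped a t = (t == if a == z i then y i else k i).
Proof.
move=> ii aV; apply/droppedP/eqP => [[] j jj|].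
- by move=> e; case: (q_notin_V lock jj ii); rewrite -e.
- by move=> e; case: (x_notin_V lock jj ii); rewrite -e.
- by move=> -> aV'; rewrite -(V_disjoint lock ii jj aV aV'); case: eqP.
- move=> -> az; have aV' : a \in V j by rewrite az (pencil_head pk).
  by rewrite (V_disjoint lock ii jj aV aV') az eqxx.
case: eqP => [-> ->|az ->]; first exact: (@DroppedEntry _ _ i).
exact: (@DroppedRange _ _ i).
Qed.

Lemma added_V i a t : i < n -> a \in V i -> added (Some a) t = (t == centre k i).
Proof.
move=> ii aV; apply/addedP/eqP => [[j u jj uW e ->|j u jj uV [e] ->|j jj [e]|//]|->].
- by case: j jj {uW} e => //= j jj [e]; case: (q_notin_V lock (ltnW jj) ii); rewrite -e.
- by rewrite -e in uV; rewrite (V_disjoint lock ii jj aV uV).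
- by case: (x_notin_V lock jj ii); rewrite -e.
exact: (@AddedRange _ _ _ _ _ _ _ _ _ _ _ i a).
Qed.

Lemma dropped_x i t : i < n -> dropped (x i) t = (t == N i).
Proof.
move=> ii; apply/droppedP/eqP => [[] j jj|->].
- by move=> /(pencil_x_neq_q lock ii jj).
- by move=> /(pencil_inj pq ii isT jj isT) ->.
- by move=> _ /(x_notin_V lock ii jj).
- by move=> _ e; case: (x_notin_V lock ii jj); rewrite e; apply: (pencil_head pk).
exact: (@DroppedExit _ _ i).
Qed.

Lemma added_x i t : i < n -> added (Some (x i)) t = (t == Some (y i)).
Proof.
move=> ii; apply/addedP/eqP => [[j u jj uW e ->|j u jj uV [e] ->|j jj [e] ->|//]|->].
- by case: j jj {uW} e => //= j jj [/(pencil_x_neq_q lock ii (ltnW jj))].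
- by case: (x_notin_V lock ii jj); rewrite e.
- by rewrite (pencil_inj pq ii isT jj isT e).
exact: (@AddedLink _ _ _ _ _ _ _ _ _ _ _ i).
Qed.

(** Only centres, points of some [V i] and points [x i] change lines, and these classes are
    disjoint. In the last two, one line is exchanged for another. *)
Lemma card_dropped_added a :
  #|[pred t | dropped a t]| = #|[pred t | added (Some a) t]|.
Proof.
case: (pselect (exists2 i, i < n & a = q i)) => [[i ii ->]|nq].
  rewrite (eq_card (B := W i :\ N i)); last by move=> t; rewrite inE dropped_q.
  have := cardsD1 (N i) (W i); rewrite (pencil_head pq) // (pencil_card pq) //.
  (* The centre [q i] loses n - i - 1 lines and gains the n - (i + 1) lines of [W i.+1]; the last
     centre loses and gains nothing. This is why [W j] has size n - j. *)
  have [lt|ge] := ltnP i.+1 n.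
    rewrite (eq_card (A := [pred t | added _ t]) (B := [set Some u | u in W i.+1])).
      by rewrite card_imset ?(pencil_card pq) //; [lia|move=> ? ? []].
    by move=> t; rewrite inE added_q // lt.
  rewrite (eq_card0 (A := [pred t | added _ t])); first by lia.
  by move=> t; rewrite inE added_q // ltnNge ge.
case: (pselect (exists2 i, i < n & a \in V i)) => [[i ii aV]|nV].
  rewrite (eq_card (B := pred1 (if a == z i then y i else k i))).
    rewrite (eq_card (A := [pred t | added _ t]) (B := pred1 (centre k i))).
      by rewrite !card1.
    by move=> t; rewrite !inE (added_V _ ii).
  by move=> t; rewrite !inE (dropped_V _ ii).
case: (pselect (exists2 i, i < n & a = x i)) => [[i ii ->]|nx].
  rewrite (eq_card (B := pred1 (N i))).
    rewrite (eq_card (A := [pred t | added _ t]) (B := pred1 (Some (y i)))).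
      by rewrite !card1.
    by move=> t; rewrite !inE added_x.
  by move=> t; rewrite !inE dropped_x.
rewrite !eq_card0 // => t; rewrite inE; apply/negbTE/negP.
  case/addedP=> [j u jj uW e _|j u jj uV [e] _|j jj [e] _|//].
  - by case: j jj {uW} e => //= j jj [e]; case: nq; exists j => //; apply: ltnW.
  - by case: nV; exists j; rewrite ?e.
  - by case: nx; exists j.
case/droppedP=> j jj.
- by move=> e; case: nq; exists j.
- by move=> e; case: nx; exists j.
- by move=> _ aV; case: nV; exists j.
- by move=> _ e; case: nV; exists j; rewrite ?e ?(pencil_head pk).
Qed.

Lemma extension_point_degree :
  (forall a, #|[pred t | I a t]| = n.+1) -> 0 < n ->
  forall a, #|[pred t | extension a t]| = n.+1.
Proof.
move=> dI n0 [a|]; last first.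
  (* The new point lies on the [n] lines of [W 0] and on the new line. *)
  rewrite (eq_card (B := None |: [set Some u | u in W 0])).
    rewrite cardsU1 card_imset; last by move=> ? ? [].
    rewrite (pencil_card pq) // subn0; case: imsetP => // -[u _ //].
  move=> [t|]; rewrite !inE /extension /=; last first.
    by apply/addedP; apply: AddedNew.
  rewrite /= mem_imset; last by move=> ? ? [].
  apply/addedP/idP => [[j u jj uW|//|//|//]|tW].
    by case: j jj uW => // jj uW _ [->].
  exact: (@AddedPencil _ _ _ _ _ _ _ _ _ _ _ 0 t).
have := dI a; rewrite -(cardID [pred t | dropped a t]).
rewrite (eq_card (B := [pred t | dropped a t])); last first.
  move=> t; rewrite !inE andbC; case: (boolP (dropped a t)) => //= h.
  by rewrite dropped_inc.
rewrite card_dropped_added => <-; rewrite addnC.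
rewrite -(cardID [pred t | kept (Some a) t]); congr (_ + _).
  rewrite -[RHS](card_imset (f := Some)); last by move=> ? ? [].
  apply: eq_card => t; rewrite !inE.
  apply/andP/imsetP => [[]|[u]].
    case: t => [t|] //= _ /and3P[h1 h2 h3]; exists t => //.
    by rewrite !inE h1 /dropped negb_or h2 h3.
  rewrite !inE /dropped negb_or => /andP[/andP[h2 h3] h1] ->.
  by rewrite /extension /= h1 h2 h3.
apply: eq_card => t; rewrite !inE /extension.
(* Kept incidences stay on one side and added ones change sides, so none is counted twice. *)
case: (boolP (kept (Some a) t)) => //= kt; apply/esym/negbTE/negP => /(added_side lock) /=.
by case: t kt => //= t /andP[/(lock_side lock) ->]; case: (sL t).
Qed.

End Degree.

Lemma interlock_configuration (P L : finType) (I : P -> L -> bool) n q x z k y N W V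
    sP sL d :
  configuration d d n.+1 n.+1 I -> 0 < n ->
  interlock I n q x z k y N W V sP sL ->
  configuration d.+1 d.+1 n.+1 n.+1 (extension I n q x z k y N W V).
Proof.
move=> c n0 lock; split.
- by rewrite card_option (card_points c).
- by rewrite card_option (card_lines c).
- exact: (extension_point_degree lock (point_degree c)).
- move=> t; rewrite -(extension_point_degree (interlock_dual lock) (line_degree c) n0 t).
  apply: eq_card => a; rewrite !inE /extension kept_dual added_dual //.
- exact: (interlock_linear (common_line c) lock).
Qed.

(** * Greedy choice of the chains *)

(** Greedy choice: fewer elements are already taken than each set contains. *)
Lemma distinct_representatives (T : finType) (x0 : T) (S : nat -> {set T})
    (s : seq nat) :
  uniq s -> {in s, forall i, size s <= #|S i|} ->
  exists f : nat -> T, {in s &, injective f} /\ {in s, forall i, f i \in S i}.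
Proof.
elim: s => [|i s IHs] /= => [_ _|/andP[_ us] hS]; first by exists (fun=> x0).
have [j js|f [finj fS]] := IHs us.
  by apply/ltnW/hS; rewrite inE js orbT.
have : 0 < #|S i :\: [set w in map f s]|.
  have := hS i (mem_head _ _); rewrite -(cardsID [set w in map f s]).
  have : #|[set w in map f s]| <= size s.
    by rewrite cardsE (leq_trans (card_size _)) // size_map.
  have := subset_leq_card (subsetIr (S i) [set w in map f s]).
  lia.
case/card_gt0P => w; rewrite !inE => /andP[wf wS].
exists (fun j => if j == i then w else f j); split.
  have fw j : j \in s -> f j <> w by move=> js e; case/mapP: wf; exists j.
  move=> j1 j2; rewrite !inE.
  case: eqP => [->|_]; case: eqP => [->|_] //= h1 h2; first by move/esym/fw; case.
    by move/fw; case.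
  exact: finj.
by move=> j; rewrite inE; case: eqP => [->//|_] /= /fS.
Qed.

Lemma exists_subset_card (T : finType) (S : {set T}) (w : T) m :
  w \in S -> 0 < m <= #|S| ->
  exists V : {set T}, [/\ V \subset S, w \in V & #|V| = m].
Proof.
move=> wS /andP[m0 mS].
have [V] : exists V : {set T}, V \subset S :\ w /\ #|V| = m.-1.
  have : 0 < #|[set V : {set T} | V \subset S :\ w & #|V| == m.-1]|.
    by rewrite cards_draws bin_gt0; have := cardsD1 w S; rewrite wS; lia.
  by case/card_gt0P => V; rewrite inE => /andP[h /eqP]; exists V.
case=> /subsetD1P[VS wV] cV; exists (w |: V); split.
- by rewrite subUset sub1set wS.
- by rewrite setU11.
- by rewrite cardsU1 wV cV add1n prednK.
Qed.

Lemma card_cover_le (T : finType) (s : seq nat) (A : nat -> {set T}) (B : {set T}) c :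
  (forall w, w \in B -> exists2 i, i \in s & w \in A i) ->
  {in s, forall i, #|A i| <= c} -> #|B| <= size s * c.
Proof.
elim: s B => [|i s IHs] B hB hA /=.
  by rewrite leqn0 cards_eq0; apply/eqP/setP => w; rewrite inE; apply/negP => /hB[].
have := subset_leq_card (subsetIr B (A i)).
have := hA i (mem_head _ _); have := cardsID (A i) B.
have : #|B :\: A i| <= size s * c.
  apply: IHs => [w /setDP[/hB[j]]|j js]; last by apply: hA; rewrite inE js orbT.
  by rewrite inE => /orP[/eqP-> -> //|js wj _]; exists j.
lia.
Qed.

(** * Points joined to a given point by a line other than a given one *)

Definition reach (P L : finType) (I : P -> L -> bool) (q : P) (m : L) :=
  [set x | (x != q) && [exists t, [&& I q t, t != m & I x t]]].

Section Reach.

Variables (v b n : nat) (P L : finType) (I : P -> L -> bool).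
Hypothesis c : configuration v b n.+1 n.+1 I.

Lemma card_line_minus o m : I o m -> #|[set p | (p != o) && I p m]| = n.
Proof.
move=> om; have d := line_degree c m; rewrite (cardD1 o) inE om in d.
by case: d => <-; rewrite cardsE; apply: eq_card => p; rewrite !inE.
Qed.

Lemma card_pencil_minus o m : I o m -> #|[set t | (t != m) && I o t]| = n.
Proof.
move=> om; have d := point_degree c o; rewrite (cardD1 m) inE om in d.
by case: d => <-; rewrite cardsE; apply: eq_card => p; rewrite !inE.
Qed.

(** There are [n] further lines through [q] with [n] further points each, all distinct since two of
    these lines share only [q]. *)
Lemma card_reach q m : I q m -> #|reach I q m| = n * n.
Proof.
move=> qm.
pose U := [set u : L * P | [&& u.1 != m, I q u.1, u.2 != q & I u.2 u.1]].
have -> : reach I q m = [set u.2 | u in U].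
  apply/setP => x; rewrite inE; apply/andP/imsetP.
    move=> [xq /existsP[t /and3P[h1 h2 h3]]]; exists (t, x) => //.
    by rewrite inE /= h1 h2 h3 xq.
  move=> [[t y]]; rewrite inE /= => /and4P[h1 h2 h3 h4] ->; split=> //.
  by apply/existsP; exists t; rewrite h1 h2 h4.
rewrite card_in_imset; last first.
  move=> [t x] [t' x']; rewrite !inE /= => /and4P[h1 h2 /eqP h3 h4] /and4P[_ g2 _ g4] e.
  by rewrite -e in g4 *; rewrite (common_line c h3 h4 h2 g4 g2).
rewrite -sum1_card.
rewrite (eq_bigl (fun u : L * P => ((u.1 != m) && I q u.1) && ((u.2 != q) && I u.2 u.1)));
  last by move=> u; rewrite inE -!andbA.
rewrite -(pair_big_dep (fun t => (t != m) && I q t) (fun t x => (x != q) && I x t) (fun _ _ => 1)) /=.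
rewrite (eq_bigr (fun=> n)) => [|t /andP[_ qt]].
  by rewrite sum_nat_const -{2}(card_pencil_minus qm) cardsE mulnC.
by rewrite sum1_card -(card_line_minus qt) cardsE.
Qed.

Lemma reachN o q m : I q m -> I o m -> o \notin reach I q m.
Proof.
move=> qm om; rewrite inE; apply/andP => -[/eqP oq /existsP[t /and3P[qt /eqP tm ot]]].
by apply: tm; apply: (common_line c oq).
Qed.

(** The point [o] of [k] is not reached, as its line to [q] is [m]. *)
Lemma card_reach_concurrent o q m k : I q m -> I o m -> I o k ->
  #|reach I q m :&: [set x | I x k]| <= n.
Proof.
move=> qm om ok; rewrite -(card_line_minus ok); apply/subset_leq_card/subsetP => x.
rewrite !inE => /andP[xr ->]; rewrite andbT; apply: contraTneq (reachN qm om) => <-.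
by rewrite inE negbK.
Qed.

Lemma card_reach_line q m y : I q m -> ~~ I q y ->
  #|reach I q m :&: [set x | I x y]| <= n.
Proof.
move=> qm qy; rewrite -(card_pencil_minus qm).
(* For reached [x] this is a line joining [x] to [q], the default [m] being excluded. Two points of
   [y] with the same such line would force it to be [y], which misses [q]. *)
pose f x := odflt m [pick t | [&& I q t, t != m & I x t]].
have fP x : x \in reach I q m -> [&& I q (f x), f x != m & I x (f x)].
  rewrite inE => /andP[_ /existsP[t ht]]; rewrite /f; case: pickP => [u //|/(_ t)].
  by rewrite ht.
rewrite -(card_in_imset (f := f)).
  apply/subset_leq_card/subsetP => t /imsetP[x]; rewrite in_setI => /andP[/fP/and3P[h1 h2 _] _] ->.
  by rewrite inE h1 h2.
move=> x x'; rewrite in_setI => /andP[/fP/and3P[h1 _ h2]]; rewrite inE => xy.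
rewrite in_setI => /andP[/fP/and3P[g1 _ g2]]; rewrite inE => xy' e.
apply/eqP; apply: contraTT qy => /eqP xx; rewrite negbK.
by rewrite -e in g2; rewrite -(common_line c xx h2 g2 xy xy').
Qed.

(** Each line contributes at most [n] points. One is saved at [z]: if reached it is counted twice,
    otherwise [k] loses both [o] and [z]. *)
Lemma card_reach_crossing o q m k y z : I q m -> I o m -> I o k -> I z k ->
  z <> o -> I z y -> ~~ I q y ->
  #|reach I q m :&: [set x | I x k || I x y]| < n + n.
Proof.
move=> qm om ok zk zo zy qy.
set R := reach I q m; set A := R :&: [set x | I x k]; set B := R :&: [set x | I x y].
have zo' : z != o by apply/eqP.
have oA : o \notin A by rewrite inE negb_and (reachN qm om).
have cA : #|A :|: [set z]| <= n.
  rewrite -(card_line_minus ok); apply/subset_leq_card/subsetP => x.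
  rewrite in_setU in_set1 inE => /orP[xA|/eqP->]; last by rewrite zo' zk.
  apply/andP; split; first by apply: contraNneq oA => <-.
  by move: xA; rewrite !inE => /andP[].
have cB := card_reach_line qm qy; rewrite -/R -/B in cB.
have -> : R :&: [set x | I x k || I x y] = A :|: B.
  by apply/setP => x; rewrite !inE andb_orr.
have [zR|zR] := boolP (z \in R).
  have zAB : z \in A :&: B by rewrite !in_setI zR !inE zk zy.
  have : 0 < #|A :&: B| by apply/card_gt0P; exists z.
  have : #|A| <= #|A :|: [set z]| by apply/subset_leq_card/subsetUl.
  have := subset_leq_card (subsetIl A B).
  rewrite [#|A :|: B|]cardsU; lia.
have zA : z \notin A by rewrite in_setI (negPf zR).
move: cA; rewrite setUC cardsU1 zA; have [+ _] := leq_card_setU A B; lia.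
Qed.

End Reach.

Definition indices n (e : pred nat) := [seq i <- iota 0 n | e i].

Lemma mem_indices n e i : (i \in indices n e) = (i < n) && e i.
Proof. by rewrite mem_filter mem_iota /= andbC. Qed.

Lemma size_indicesC n e : size (indices n e) + size (indices n (predC e)) = n.
Proof. by rewrite !size_filter count_predC size_iota. Qed.

Lemma size_indices_odd n : size (indices n odd) = n./2.
Proof.
rewrite size_filter; elim: n => // n IHn.
by rewrite -addn1 iotaD count_cat IHn /=; lia.
Qed.

Lemma greedy_bound n a b w : a + b = n -> 0 < a -> w <= b * n -> w + a <= n * n.
Proof. nia. Qed.

(** Here b(2n - 1) + a = 2b(n - 1) + n, at most n(n - 1) + n. With 2n in place of 2n - 1 the bound
    would fail at b = n/2, so the point saved in [card_reach_crossing] matters. *)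
Lemma double_greedy_bound n a b w :
  a + b = n -> b.*2 <= n -> w <= b * (n + n).-1 -> w + a <= n * n.
Proof.
case: n => [|n] ab bn h; first by lia.
have := leq_mul bn (leqnn n); rewrite -muln2; move: h; rewrite addSn /=; nia.
Qed.

(** Each reach has n^2 points, so outside [F] there remain at least as many as there are indices,
    and distinct [x j] can be picked. [N j] joins [x j] to [q j], and [W j] is filled up with lines
    through [q j] other than [m]. *)
Lemma pencils_exist v b n (P L : finType) (I : P -> L -> bool) (e : pred nat)
    (q : nat -> P) (m : L) (F : {set P}) :
  configuration v b n.+1 n.+1 I ->
  (forall j, j < n -> e j -> I (q j) m) ->
  (forall i j, i < n -> e i -> j < n -> e j -> q i = q j -> i = j) ->
  (forall j, j < n -> e j ->
    #|reach I (q j) m :&: F| + size (indices n e) <= n * n) ->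
  exists x N W, [/\ pencils I n e q x N W,
    forall j, j < n -> e j -> x j \notin F & forall j, j < n -> e j -> N j <> m].
Proof.
move=> c qm qinj hF.
have [|i|x [xinj xS]] := @distinct_representatives _ (q 0)
    (fun j => reach I (q j) m :\: F) (indices n e).
- exact: filter_uniq (iota_uniq _ _).
- rewrite mem_indices => /andP[ii ei]; have := hF i ii ei.
  by rewrite -(card_reach c (qm i ii ei)) -(cardsID F (reach I (q i) m)); lia.
have xP j : j < n -> e j -> x j \in reach I (q j) m :\: F.
  by move=> jj ej; apply: xS; rewrite mem_indices jj.
have [N NP] : {N & forall j, j < n -> e j ->
    [/\ I (q j) (N j), N j != m & I (x j) (N j)]}.
  apply: (@boolp.choice _ _ (fun j t => j < n -> e j ->
    [/\ I (q j) t, t != m & I (x j) t])) => j.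
  case: (boolP ((j < n) && e j)) => [/andP[jj ej]|h]; last first.
    by exists m => jj ej; rewrite jj ej in h.
  have := xP j jj ej; rewrite !inE => /and3P[_ _ /existsP[t /and3P[]]].
  by exists t.
have [W WP] : {W : nat -> {set L} & forall j, j < n -> e j ->
    [/\ W j \subset [set t | (t != m) && I (q j) t], N j \in W j & #|W j| = n - j]}.
  apply: (@boolp.choice _ _ (fun j (A : {set L}) => j < n -> e j ->
    [/\ A \subset [set t | (t != m) && I (q j) t], N j \in A & #|A| = n - j])) => j.
  case: (boolP ((j < n) && e j)) => [/andP[jj ej]|h]; last first.
    by exists set0 => jj ej; rewrite jj ej in h.
  have [h1 h2 _] := NP j jj ej.
  have [||V VP] := @exists_subset_card _ [set t | (t != m) && I (q j) t] (N j) (n - j).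
  - by rewrite inE h1 h2.
  - by rewrite (card_pencil_minus c) ?qm //; lia.
  by exists V.
have WE j t : j < n -> e j -> t \in W j -> t <> m /\ I (q j) t.
  move=> jj ej; have [/subsetP h _ _] := WP j jj ej.
  by move=> /h; rewrite inE => /andP[/eqP].
exists x, N, W; split; [split|..].
- by move=> j jj ej; case: (WP j jj ej).
- by move=> j t jj ej /(WE _ _ jj ej)[].
(* Distinct [q i] and [q j] have [m] as common line, and [m] is in no pencil. *)
- move=> i j t ii ei jj ej /(WE _ _ jj ej)[tm qt] qit; apply: qinj => //.
  apply/eqP; apply: contraT => /eqP qq; case: tm.
  by apply: (common_line c qq qit qt); apply: qm.
- by move=> j jj ej; case: (WP j jj ej).
- by move=> j jj ej; case: (NP j jj ej).
- by move=> j jj ej; have := xP j jj ej; rewrite !inE => /and3P[_ /eqP].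
- by move=> i j ii ei jj ej; apply: xinj; rewrite mem_indices ?ii ?jj.
- by move=> j jj ej; have := xP j jj ej; rewrite in_setD => /andP[].
- by move=> j jj ej; have [_ /eqP] := NP j jj ej.
Qed.

Lemma exists_enumeration (T : finType) (A : {set T}) (w : T) :
  exists f : nat -> T, (forall j, j < #|A| -> f j \in A) /\
    forall i j, i < #|A| -> j < #|A| -> f i = f j -> i = j.
Proof.
exists (nth w (enum A)); split=> [j jj|i j ii jj /eqP].
  by rewrite -mem_enum mem_nth // -cardE.
by rewrite nth_uniq -?cardE ?enum_uniq // => /eqP.
Qed.

(** The part of both chains lying in one configuration: points at the indices in [e], lines at the
    others. For A, [e] is the set of even indices; for B, the odd ones. *)
Record half (P L : finType) (I : P -> L -> bool) n (e : pred nat)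
    q x z k y N W V : Prop := Half {
  half_points : pencils I n e q x N W;
  half_lines : pencils (fun l p => I p l) n (predC e) k y z V;
  half_qk : forall i j, i < n -> e i -> j < n -> ~~ e j -> I (q i) (k j) = false;
  half_qy : forall i j, i < n -> e i -> j < n -> ~~ e j -> I (q i) (y j) = false;
  half_xk : forall i j, i < n -> e i -> j < n -> ~~ e j -> I (x i) (k j) = false
}.

(* The [q j] lie on a line [m] and the [k j] pass through a point [o] of [m].
   Each [x j] is picked among the [n ^ 2] points joined to [q j] by a line other
   than [m]. Avoiding the lines [y j] as well is possible on one side only,
   which is enough: a 4-cycle through two new incidences [(x i, y i)] and
   [(x j, y j)] would need one old incidence on each side. *)
Lemma half_exists v b n (P L : finType) (I : P -> L -> bool) (e : pred nat) :
  configuration v b n.+1 n.+1 I -> 0 < v ->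
  exists q x z k y N W V, half I n e q x z k y N W V /\
    ((size (indices n (predC e))).*2 <= n ->
      forall i j, i < n -> e i -> j < n -> ~~ e j -> I (x i) (y j) = false).
Proof.
move=> c v0; have [o [m om]] := exists_flag c v0 isT.
have c' := configuration_dual c.
have cm := card_line_minus c om; have co := card_pencil_minus c om.
have [q [qP qinj]] := exists_enumeration [set p | (p != o) && I p m] o.
have [k [kP kinj]] := exists_enumeration [set t | (t != m) && I o t] m.
rewrite cm in qP qinj; rewrite co in kP kinj.
have {}qP j : j < n -> q j <> o /\ I (q j) m.
  by move=> /qP; rewrite inE => /andP[/eqP].
have {}kP j : j < n -> k j <> m /\ I o (k j).
  by move=> /kP; rewrite inE => /andP[/eqP].
have qk i j : i < n -> j < n -> I (q i) (k j) = false.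
  move=> /qP[qo qm] /kP[km ok]; apply/negP => h; apply: km.
  exact: (common_line c qo).
have sz := size_indicesC n e.
have pos (f : pred nat) j : j < n -> f j -> 0 < size (indices n f).
  by move=> jj fj; rewrite -has_predT; apply/hasP; exists j; rewrite ?mem_indices ?jj.
(* Lines forbidden for the [y j], which are chosen first. *)
pose G := [set t | [exists i : 'I_n, e i && I (q i) t]].
have [||j jj ej|y [z [V [pk yG zo]]]] := @pencils_exist _ _ _ _ _ _ (predC e) k o G c'.
- by move=> j /kP[].
- by move=> i j ii _ jj _; apply: kinj.
- have h : #|reach (fun l p => I p l) (k j) o :&: G| <= size (indices n e) * n.
    apply: (@card_cover_le _ _
      (fun i => reach (fun l p => I p l) (k j) o :&: [set t | I (q i) t])).
      move=> t; rewrite in_setI => /andP[tr]; rewrite inE => /existsP[i /andP[ei qt]].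
      by exists (i : nat); rewrite ?mem_indices ?ltn_ord // in_setI tr inE.
    move=> i; rewrite mem_indices => /andP[ii _].
    by apply: (card_reach_concurrent c' (o := m)) => //; [case: (kP j)|case: (qP i)].
  by apply: greedy_bound (pos _ j jj ej) h; rewrite addnC.
(* Points forbidden for the [x j]: those on some [k i] and, when [d] holds, those on some [y i]. *)
pose F (d : bool) := [set p | [exists i : 'I_n, ~~ e i && (I p (k i) || d && I p (y i))]].
have qy i j : i < n -> e i -> j < n -> ~~ e j -> I (q i) (y j) = false.
  move=> ii ei jj ej; have := yG j jj ej; rewrite inE negb_exists.
  by move=> /forallP/(_ (Ordinal ii)) /=; rewrite ei => /negbTE.
pose d := (size (indices n (predC e))).*2 <= n.
have [||j jj ej|x [N [W [pq xF _]]]] := @pencils_exist _ _ _ _ _ _ e q m (F d) c.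
- by move=> j /qP[].
- by move=> i j ii _ jj _; apply: qinj.
- have h : #|reach I (q j) m :&: F d|
      <= size (indices n (predC e)) * (if d then (n + n).-1 else n).
    apply: (@card_cover_le _ _
      (fun i => reach I (q j) m :&: [set p | I p (k i) || d && I p (y i)])).
      move=> t; rewrite in_setI => /andP[tr]; rewrite inE => /existsP[i /andP[ei qt]].
      by exists (i : nat); rewrite ?mem_indices ?ltn_ord // in_setI tr inE.
    move=> i; rewrite mem_indices => /andP[ii ei].
    have [[_ qm] [_ ok]] := (qP j jj, kP i ii).
    case: (d) => /=; last first.
      rewrite (eq_card (B := reach I (q j) m :&: [set p | I p (k i)])).
        exact: (card_reach_concurrent c (o := o)).
      by move=> p; rewrite !inE orbF.
    have zk := pencil_inc pk ii ei (pencil_head pk ii ei).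
    have zy := pencil_exit pk ii ei.
    have := card_reach_crossing c qm om ok zk (zo i ii ei) zy (negbT (qy j i jj ej ii ei)).
    lia.
  move: h; case: (boolP d) => [dn|_] h.
    exact: (double_greedy_bound sz dn h).
  exact: (greedy_bound sz (pos _ j jj ej) h).
exists q, x, z, k, y, N, W, V; split; [split=> //|].
- by move=> i j ii _ jj _; apply: qk.
- move=> i j ii ei jj ej; have := xF i ii ei; rewrite inE negb_exists.
  by move=> /forallP/(_ (Ordinal jj)) /=; rewrite ej negb_or => /andP[/negbTE].
- move=> dn i j ii ei jj ej; have := xF i ii ei; rewrite inE negb_exists.
  move=> /forallP/(_ (Ordinal jj)) /=; rewrite ej negb_or /d dn /=.
  by move=> /andP[_ /negbTE].
Qed.

(** * Interleaving the two halves: s + t + 1 *)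

Definition mix (f : pred nat) (S T : Type) (a : nat -> S) (b : nat -> T) (j : nat) :
    S + T :=
  if f j then inl (a j) else inr (b j).

Definition mix_set (f : pred nat) (S T : finType) (A : nat -> {set S})
    (B : nat -> {set T}) (j : nat) : {set S + T} :=
  if f j then [set inl u | u in A j] else [set inr u | u in B j].

(** Conditions on two indices reduce to a single structure, since nothing of A is incident with or
    equal to anything of B. *)
Lemma pencils_mix (PA PB LA LB : finType) (IA : PA -> LA -> bool)
    (IB : PB -> LB -> bool) (I : PA + PB -> LA + LB -> bool) n (f g : pred nat)
    qA xA NA WA qB xB NB WB :
  (forall p l, I p l = sum_inc IA IB p l) -> (forall j, g j = ~~ f j) ->
  pencils IA n f qA xA NA WA -> pencils IB n g qB xB NB WB ->
  pencils I n xpredT (mix f qA qB) (mix f xA xB) (mix f NA NB) (mix_set f WA WB).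
Proof.
move=> IE gE pA pB; split=> [j|j t|i j t|j|j|j|i j].
- move=> jj _; rewrite /mix_set; case: (boolP (f j)) => fj.
    by rewrite card_imset ?(pencil_card pA) // => ? ? [].
  by rewrite card_imset ?(pencil_card pB) ?gE // => ? ? [].
- move=> jj _; rewrite /mix_set /mix IE; case: (boolP (f j)) => fj /imsetP[u uW ->] /=.
    exact: (pencil_inc pA).
  by apply: (pencil_inc pB); rewrite ?gE.
- move=> ii _ jj _; rewrite /mix_set /mix IE.
  case: (boolP (f j)) => fj /imsetP[u uW ->] /=; case: (boolP (f i)) => fi //=.
    exact: (pencil_uniq pA).
  by apply: (pencil_uniq pB); rewrite ?gE.
- move=> jj _; rewrite /mix_set /mix; case: (boolP (f j)) => fj; rewrite imset_f //.
    exact: (pencil_head pA).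
  by apply: (pencil_head pB); rewrite ?gE.
- move=> jj _; rewrite /mix IE; case: (boolP (f j)) => fj /=.
    exact: (pencil_exit pA).
  by apply: (pencil_exit pB); rewrite ?gE.
- move=> jj _; rewrite /mix; case: (boolP (f j)) => fj [].
    exact: (pencil_neq pA).
  by apply: (pencil_neq pB); rewrite ?gE.
- move=> ii _ jj _; rewrite /mix.
  case: (boolP (f j)) => fj; case: (boolP (f i)) => fi // [].
    exact: (pencil_inj pA).
  by apply: (pencil_inj pB); rewrite ?gE.
Qed.

Lemma configuration_add1 r s t (PA LA PB LB : finType) (IA : PA -> LA -> bool)
    (IB : PB -> LB -> bool) :
  configuration s s r r IA -> configuration t t r r IB ->
  0 < s -> 0 < t -> 1 < r -> exists (P L : finType) (I : P -> L -> bool),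
  configuration (s + t + 1) (s + t + 1) r r I.
Proof.
case: r => // n cA cB s0 t0 n0; rewrite addn1.
pose even j := ~~ odd j.
have [qA [xA [zA [kA [yA [NA [WA [VA [hA xyA]]]]]]]]] := half_exists even cA s0.
have [qB [xB [zB [kB [yB [NB [WB [VB [hB _]]]]]]]]] := half_exists odd cB t0.
have {}xyA : forall i j, i < n -> even i -> j < n -> odd j -> IA (xA i) (yA j) = false.
  (* In A the lines of the chain have odd index, and at most half of the indices below [n] are
     odd. *)
  move=> i j ii ei jj oj; apply: xyA => //; last by rewrite negbK.
  rewrite /indices (eq_filter (a2 := odd)) -?/(indices n odd); last by move=> w /=; rewrite negbK.
  by rewrite size_indices_odd; lia.
do 3! eexists; apply: (interlock_configuration (sum_inc_configuration cA cB)) => //.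
apply: (@Interlock _ _ _ _ (mix even qA qB) (mix even xA xB) (mix (predC even) zA zB)
  (mix (predC even) kA kB) (mix (predC even) yA yB) (mix even NA NB) (mix_set even WA WB)
  (mix_set (predC even) VA VB) (@is_inr _ _) (@is_inr _ _)).
- apply: pencils_mix (half_points hA) (half_points hB) => // j.
  by rewrite /even negbK.
- apply: pencils_mix (half_lines hA) (half_lines hB) => [|j].
    by case=> p [].
  by rewrite /even /= negbK.
- by case=> p [].
- by move=> j _; rewrite /mix /even; case: (odd j).
- by move=> j _; rewrite /mix /= /even; case: (odd j).
- move=> i j ii jj; rewrite /mix /even /=.
  case: (boolP (odd i)) => oi; case: (boolP (odd j)) => oj //=.
    exact: (half_qk hB).
  by apply: (half_qk hA); rewrite // negbK.
- move=> i j ii jj; rewrite /mix /even /=.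
  case: (boolP (odd i)) => oi; case: (boolP (odd j)) => oj //=.
    exact: (half_qy hB).
  by apply: (half_qy hA); rewrite // negbK.
- move=> i j ii jj; rewrite /mix /even /=.
  case: (boolP (odd i)) => oi; case: (boolP (odd j)) => oj //=.
    exact: (half_xk hB).
  by apply: (half_xk hA); rewrite // negbK.
(* For equal parities [x i] and [y j] lie on different sides; otherwise one of the two incidences
   lies in A and is excluded by [xyA]. *)
- move=> i j ii jj; rewrite /mix /even /=.
  case: (boolP (odd i)) => oi; case: (boolP (odd j)) => oj //=.
    by move=> _; rewrite xyA // /even.
  by rewrite xyA.
Qed.

Theorem theorem2p14 (r : nat) (hr : 2 <= r) : Lminus (conf_set r r).
Proof.
have r0 : 0 < r by apply: ltnW.
split.
- split.
    apply/(conf_setE _ r0); exists void, void, (fun _ _ => false).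
    by split; rewrite ?card_void //; case.
  move=> s t /(conf_setE _ r0)[PA [LA [IA cA]]] /(conf_setE _ r0)[PB [LB [IB cB]]].
  apply/(conf_setE _ r0); do 3! eexists; exact: sum_inc_configuration cA cB.
- move=> e; have [d [d0 /(conf_setE _ r0)]] := configuration_exists r0.
  by rewrite e /= => d1; rewrite d1 in d0.
move=> s t [/(conf_setE _ r0)[PA [LA [IA cA]]] s01] [/(conf_setE _ r0)[PB [LB [IB cB]]] t01].
have s0 : 0 < s by rewrite lt0n; apply/eqP => e; apply: s01; left.
have t0 : 0 < t by rewrite lt0n; apply/eqP => e; apply: t01; left.
split; apply/(conf_setE _ r0).
- exact: configuration_sub3 cA cB s0 t0 hr.
- exact: configuration_sub1 cA cB s0 t0 r0.
- exact: configuration_add1 cA cB s0 t0 hr.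
Qed.
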